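(* For any finite digraph $G$ and any $p\ge1$, $$\operatorname{spec}_+\mathcal L_p=\bigsqcup_{k=0}^{\lfloor\frac{p-1}{2}\rfloor}\operatorname{spec}_+\Delta_{p-(2k+1)}\ \setminus\ \bigsqcup_{k=1}^{\lfloor\frac p2\rfloor}\operatorname{spec}_+\Delta_{p-2k},$$ where the operators $\mathcal L_p$ and $\Delta_p$ are those of the path chain complex $\{\Omega_p(G)\}_{p\ge0}$ with an arbitrary inner product fixed on each $\Omega_p(G)$.
   Context: A digraph $G=(V,E)$ consists of a finite vertex set $V$ and a set $E$ of ordered pairs of distinct vertices (arrows), written $i\to j$. An elementary $p$-path ($p\ge 0$) is a sequence $i_0\dots i_p$ of vertices, with associated basis symbol $e_{i_0\dots i_p}$; it is regular if $i_{k-1}\ne i_k$ for all $k$, and allowed if $i_{k-1}\to i_k$ for all $k$. $\mathcal R_p$ is the real vector space with basis the regular elementary $p$-paths. The boundary operator $\partial:\mathcal R_p\to\mathcal R_{p-1}$ is $\partial e_{i_0\dots i_p}=\sum_{k=0}^p(-1)^k e_{i_0\dots\widehat{i_k}\dots i_p}$, where every non-regular term on the right is replaced by $0$; and $\mathcal R_{-1}=\{0\}$, $\partial e_i=0$. $\mathcal A_p\subset\mathcal R_p$ is the span of the allowed elementary $p$-paths ($\mathcal A_{-1}=\{0\}$), and $\Omega_p=\Omega_p(G)=\{u\in\mathcal A_p:\partial u\in\mathcal A_{p-1}\}$. Then $\partial\Omega_p\subset\Omega_{p-1}$ and $\partial^2=0$. With $\partial^*:\Omega_{p-1}\to\Omega_p$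 the adjoint of $\partial:\Omega_p\to\Omega_{p-1}$ with respect to the fixed inner products, $\mathcal L_p=\partial^*\partial|_{\Omega_p}$ and the Hodge Laplacian is $\Delta_p=\partial\partial^*+\partial^*\partial$ on $\Omega_p$. $\operatorname{spec}A$ is the multiset of eigenvalues of a self-adjoint operator $A$, counted with multiplicity, and $\operatorname{spec}_+A$ is obtained by removing all zero eigenvalues. $\sqcup$ is disjoint union of multisets (multiplicities add; an empty union is empty), and $\setminus$ is the inverse operation, subtraction of multisets (multiplicities subtract); in the displayed formula the second disjoint union is subtracted from the first. *)

(* Defs.v *)
From HB Require Import structures.
From mathcomp Require Import all_boot all_order all_algebra.
From mathcomp Require Import zify.
From mathcomp Require Import finmap multiset.
From mathcomp Require Import boolp classical_sets cardinality reals.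

Set Implicit Arguments.
Unset Strict Implicit.
Unset Printing Implicit Defensive.

Import Order.TTheory GRing.Theory Num.Theory.
Local Open Scope ring_scope.

(* Paths, chains and the spaces Omega are indexed by the number m = p + 1 of   *)
(* vertices rather than by the degree p, so that degree -1 is available as     *)
(* m = 0. There is no path with 0 vertices, hence everything in degree -1 is   *)
(* the zero space. In this indexing Omega_p is [Om E p.+1], and [bd p] below   *)
(* is the boundary operator from degree p to degree p - 1.                     *)
Section PathComplex.
Variables (R : realType) (V : finType).

Definition regular (s : seq V) : bool := sorted (fun x y => x != y) s.

Definition rpath (m : nat) : finType :=
  {t : m.-tuple V | (0 < m)%N && regular t}.

Definition chain (m : nat) : vectType R := {ffun rpath m -> R^o}.

(* The basis vector attached to a regular path, and 0 if t is not regular. *)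
Definition epath m (t : m.-tuple V) : chain m :=
  [ffun s : rpath m => (val s == t)%:R].

Definition face m (k : 'I_m.+1) (t : m.+1.-tuple V) : m.-tuple V :=
  [tuple tnth t (lift k i) | i < m].

Definition bd_path m (t : m.+1.-tuple V) : chain m :=
  \sum_(k < m.+1) (-1) ^+ k *: epath (face k t).

Definition bd m : 'Hom(chain m.+1, chain m) :=
  linfun (fun u : chain m.+1 => \sum_(s : rpath m.+1) u s *: bd_path (val s)).

Fact bd_subproof m :
  linear (fun u : chain m.+1 => \sum_(s : rpath m.+1) u s *: bd_path (val s)).
Proof.
move=> a u v; rewrite scaler_sumr -big_split; apply: eq_bigr => s _ /=.
by rewrite !ffunE scalerDl scalerA.
Qed.

Lemma bdE m (u : chain m.+1) :
  bd m u = \sum_(s : rpath m.+1) u s *: bd_path (val s).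
Proof.
pose M := GRing.isLinear.Build _ _ _ _ _ (@bd_subproof m).
pose f : {linear chain m.+1 -> chain m} := HB.pack
  (fun u : chain m.+1 => \sum_(s : rpath m.+1) u s *: bd_path (val s)) M.
exact: (lfunE f).
Qed.

Lemma bd_epath m (t : m.+1.-tuple V) :
  regular t -> bd m (epath t) = bd_path t.
Proof.
move=> reg_t; pose s0 : rpath m.+1 := Sub t reg_t.
rewrite bdE (bigD1 s0) //= ffunE /= eqxx scale1r big1 ?addr0 // => s ne_s.
rewrite ffunE; case: eqP => [eq_s|]; last by rewrite scale0r.
by case/eqP: ne_s; apply: val_inj.
Qed.

Lemma nth_face m (k : 'I_m.+1) (t : m.+1.-tuple V) x i :
  (i < m)%N -> nth x (face k t) i = nth x t (bump k i).
Proof.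
move=> lt_im; rewrite -[i]/(val (Ordinal lt_im)) -tnth_nth tnth_mktuple.
by rewrite (tnth_nth x).
Qed.

Lemma irregularP (s : seq V) x : reflect
  (exists2 j, (j.+1 < size s)%N & nth x s j = nth x s j.+1) (~~ regular s).
Proof.
apply: (iffP idP) => [|[j lt_j eq_j]]; last first.
  by apply/negP => /(sortedP x) /(_ j lt_j); rewrite eq_j eqxx.
case: (altP (@allP _ (fun j => nth x s j != nth x s j.+1) (iota 0 (size s).-1))).
  move=> Hall /negP[]; apply/(sortedP x) => i lt_i; apply: Hall.
  by rewrite mem_iota add0n /=; case: (size s) lt_i.
move=> /allPn[j]; rewrite mem_iota add0n negbK /= => lt_j /eqP eq_j _.
by exists j => //; case: (size s) lt_j.
Qed.

Lemma epath_irregular m (t : m.-tuple V) : ~~ regular t -> epath t = 0.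
Proof.
move=> irr_t; apply/ffunP => s; rewrite !ffunE; case: eqP => // eq_s.
by case/negP: irr_t; rewrite -eq_s; case/andP: (valP s).
Qed.

Lemma bd_path_irregular m (t : m.+1.-tuple V) : ~~ regular t -> bd_path t = 0.
Proof.
move=> irr_t; have x := thead t.
have /(irregularP _ x)[j] := irr_t; rewrite size_tuple => lt_j eq_j.
pose k0 : 'I_m.+1 := Ordinal (ltnW lt_j); pose k1 : 'I_m.+1 := Ordinal lt_j.
have ne_k : k1 != k0 by rewrite -val_eqE /= neq_ltn ltnSn orbT.
rewrite /bd_path (bigD1 k0) //= (bigD1 k1) //= big1 => [|k].
  suff ->: face k1 t = face k0 t.
    by rewrite exprS mulN1r scaleNr addr0 subrr.
  apply/val_inj/(@eq_from_nth _ x); rewrite !size_tuple // => i lt_i.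
  rewrite !nth_face //=; have [->|ne_ij] := eqVneq i j.
    by rewrite /bump leqnn ltnn add0n add1n eq_j.
  by congr (nth x t _); rewrite /bump; lia.
move=> /andP[nek0 nek1]; rewrite epath_irregular ?scaler0 //.
move: nek0 nek1; rewrite -!val_eqE /= => nek0 nek1.
have [lt_kj|lt_jk|eq_kj] := ltngtP k j; last by rewrite eq_kj eqxx in nek0.
  case: j lt_j eq_j lt_kj {k0 k1 ne_k nek0 nek1} => // j lt_j eq_j lt_kj.
  apply/(irregularP (face k t) x); exists j; rewrite ?size_tuple //.
  rewrite !nth_face ?(ltnW lt_j) //; last by lia.
  have [-> ->] : bump k j = j.+1 /\ bump k j.+1 = j.+2 by rewrite /bump; lia.
  by [].
have {}lt_jk : (j.+1 < k)%N by rewrite ltn_neqAle eq_sym nek1.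
have lt_jm : (j.+1 < m)%N by rewrite -ltnS (leq_trans _ (ltn_ord k)).
apply/(irregularP (face k t) x); exists j; rewrite ?size_tuple //.
rewrite !nth_face ?(ltnW lt_jm) //.
have [-> ->] : bump k j = j /\ bump k j.+1 = j.+1 by rewrite /bump; lia.
by [].
Qed.

Lemma bd_bd m (u : chain m.+2) : bd m (bd m.+1 u) = 0.
Proof.
rewrite [bd m.+1 u]bdE linear_sum big1 //= => s _; rewrite linearZ /=.
suff ->: bd m (bd_path (val s)) = 0 by rewrite scaler0.
set t := val s; rewrite /bd_path linear_sum /=.
under eq_bigr => k _.
  rewrite linearZ /=.
  have -> : bd m (epath (face k t)) = bd_path (face k t).
    have [reg|irr] := boolP (regular (face k t)); first exact: bd_epath.
    by rewrite epath_irregular // linear0 bd_path_irregular.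
  rewrite scaler_sumr; under eq_bigr do rewrite scalerA -exprD.
  over.
pose F (k : 'I_m.+2) (l : 'I_m.+1) : chain m :=
  (-1) ^+ (k + l) *: epath (face l (face k t)).
rewrite (pair_big predT predT F) /=.
rewrite (bigID (fun p : 'I_m.+2 * 'I_m.+1 => (p.2 < p.1)%N)) /=.
pose h (p : 'I_m.+2 * 'I_m.+1) : 'I_m.+2 * 'I_m.+1 :=
  if (p.2 < p.1)%N then (inord p.2, inord p.1.-1) else (inord p.2.+1, inord p.1).
have h_lt (k : 'I_m.+2) (l : 'I_m.+1) : (l < k)%N ->
    (inord l : 'I_m.+2) = l :> nat /\ (inord k.-1 : 'I_m.+1) = k.-1 :> nat.
  by have := ltn_ord k; have := ltn_ord l; split; rewrite inordK; lia.
have h_ge (k : 'I_m.+2) (l : 'I_m.+1) : (k <= l)%N ->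
    (inord l.+1 : 'I_m.+2) = l.+1 :> nat /\ (inord k : 'I_m.+1) = k :> nat.
  by have := ltn_ord k; have := ltn_ord l; split; rewrite inordK; lia.
rewrite (reindex_onto h h) /= => [|[k l] /= lt_lk]; last first.
  have [El Ek] := h_lt _ _ lt_lk; rewrite /h /= lt_lk /= El Ek ifF; last by lia.
  by congr (_, _); apply: val_inj; rewrite /= inordK; have := ltn_ord k; lia.
rewrite addrC; apply/eqP; rewrite addr_eq0 -sumrN; apply/eqP.
apply: eq_big => [[k l]|[k l]] /=; rewrite -leqNgt.
  rewrite /h /=; have [lt_lk|le_kl] := ltnP l k; rewrite /=.
    by have [-> ->] := h_lt _ _ lt_lk; lia.
  have [-> ->] := h_ge _ _ le_kl; rewrite ltnS le_kl /=.
  by apply/esym/eqP; congr (_, _); apply: val_inj; rewrite /= inordK.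
move=> le_kl; have [El Ek] := h_ge _ _ le_kl.
have -> : h (k, l) = (inord l.+1, inord k) by rewrite /h /= ltnNge le_kl.
rewrite /F /= El Ek.
rewrite addSn exprS mulN1r scaleNr opprK addnC; congr (_ *: epath _).
have x := thead t; apply/val_inj/(@eq_from_nth _ x); rewrite !size_tuple // => i lt_i.
rewrite !nth_face ?El ?Ek //; try by rewrite /bump; lia.
by congr (nth x t _); rewrite /bump; lia.
Qed.

Variable E : rel V.

Definition allowed m (t : m.-tuple V) : bool := sorted E t.

(* The empty tuple contributes [epath] = 0, so that [Allowed 0] is zero. *)
Definition Allowed m : {vspace chain m} :=
  <<[seq epath t | t : m.-tuple V in [pred t | allowed t]]>>%VS.

Definition Omega m : {vspace chain m} :=
  match m return {vspace chain m} with
  | 0 => Allowed 0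
  | m'.+1 => (Allowed m'.+1 :&: bd m' @^-1: Allowed m')%VS
  end.

Definition Om m : vectType R := subvs_of (Omega m).

(* [vsproj] only corestricts: [bd m] maps Omega into Omega, see [bdOE]. *)
Definition bdO m : 'Hom(Om m.+1, Om m) :=
  linfun (fun u : Om m.+1 => vsproj (Omega m) (bd m (vsval u))).

Lemma chain0 (u : chain 0) : u = 0.
Proof. by apply/ffunP => -[]. Qed.

Lemma bd_Omega m (u : Om m.+1) : bd m (vsval u) \in Omega m.
Proof.
have : vsval u \in Omega m.+1 by apply: subvsP.
rewrite memv_cap => /andP[_]; rewrite -memv_preim.
case: m u => [|m] u bd_u; first by rewrite [bd _ _]chain0 mem0v.
by rewrite memv_cap bd_u -memv_preim bd_bd mem0v.
Qed.

Lemma bdOE m (u : Om m.+1) : vsval (bdO m u) = bd m (vsval u).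
Proof.
rewrite -[RHS](vsprojK (bd_Omega u)); congr vsval.
exact: (lfunE (vsproj (Omega m) \o bd m \o @vsval _ _ (Omega m.+1))).
Qed.

End PathComplex.

Section Adjoint.
Variables (R : realType) (U W : vectType R).
Variables (ipU : {dot U for idfun}) (ipW : {dot W for idfun}).

Definition is_adjoint (f : 'Hom(U, W)) (g : 'Hom(W, U)) : Prop :=
  forall u w, ipW (f u) w = ipU u (g w).

(* Total by [xget]; [adjointP] and [adjoint_uniq] show that it is the unique   *)
(* linear map satisfying [is_adjoint f].                                       *)
Definition adjoint (f : 'Hom(U, W)) : 'Hom(W, U) :=
  xget 0 [set g | is_adjoint f g]%classic.

Lemma dot_inj v v' : (forall u, ipU u v = ipU u v') -> v = v'.
Proof.
move=> eq_vv'; apply/eqP; rewrite -subr_eq0; apply: contraT => nz.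
by have := neq0_dnorm_gt0 (s := ipU) _ nz; rewrite linearBr /= eq_vv' subrr ltxx.
Qed.

Lemma dotC u v : ipU u v = ipU v u.
Proof. by rewrite hermC expr0 mul1r. Qed.

Lemma riesz (phi : {linear U -> R^o}) : exists v, forall u, phi u = ipU u v.
Proof.
pose n := \dim {:U}; pose b := vbasis {:U}.
pose G : 'M[R]_n := \matrix_(i, j) ipU b`_i b`_j.
have G_free : row_free G.
  rewrite -kermx_eq0; apply/eqP/row_matrixP => i; rewrite row0.
  set c := row i _; have cG : c *m G = 0 by rewrite -row_mul mulmx_ker row0.
  pose v := \sum_k c 0 k *: b`_k.
  have v0 : v = 0.
    apply: dot_inj => u; rewrite linear0r [u](coord_vbasis (memvf u)).
    rewrite linear_sumlz big1 // => j _; rewrite linearZl_LR /=.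
    have := congr1 (fun M : 'rV_n => M 0 j) cG; rewrite !mxE => e.
    rewrite /v linear_sumr (eq_bigr (fun k => c 0 k * G k j)) ?e ?mulr0 // => k _.
    by rewrite linearZr_LR /= [G k j]mxE dotC.
  apply/rowP => k; rewrite [RHS]mxE.
  have /freeP free_b := basis_free (vbasisP {:U}).
  exact: (free_b (fun k => c 0 k)).
have G_unit : G \in unitmx by rewrite -row_free_unit.
pose c : 'rV[R]_n := (\row_j phi b`_j) *m invmx G.
exists (\sum_k c 0 k *: b`_k) => u; rewrite [u](coord_vbasis (memvf u)).
rewrite linear_sum linear_sumlz; apply: eq_bigr => j _ /=.
rewrite linearZ linearZl_LR /=; congr (_ * _).
have := congr1 (fun M : 'rV_n => M 0 j) (mulmxKV G_unit (\row_j phi b`_j)).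
rewrite !mxE => <-; rewrite linear_sumr; apply: eq_bigr => k _.
by rewrite linearZr_LR /= [G k j]mxE dotC.
Qed.

Lemma adjointP f : is_adjoint f (adjoint f).
Proof.
rewrite /adjoint; case: xgetP => [g -> //|no_adj].
have /choice[g gP] w : exists v, forall u, ipW (f u) w = ipU u v.
  exact: (riesz (applyr ipW w \o f)).
have g_lin : linear g.
  move=> a w w'; apply: dot_inj => u.
  by rewrite -gP !linearDr !linearZr_LR /= !gP.
pose g' : {linear W -> U} := HB.pack g (GRing.isLinear.Build _ _ _ _ g g_lin).
by case: (no_adj (linfun g')) => u w; rewrite lfunE gP.
Qed.

Lemma adjoint_uniq f g : is_adjoint f g -> g = adjoint f.
Proof.
move=> adj_g; apply/lfunP => w; apply: dot_inj => u.
by rewrite -adj_g adjointP.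
Qed.

End Adjoint.

Section Spectrum.
Variables (R : realType) (U : vectType R).

(* For a self-adjoint operator the multiplicity of an eigenvalue is the        *)
(* dimension of its eigenspace.                                                *)
Definition spec (A : 'End(U)) : {mset R}%mset :=
  [fsfun a in fset_set [set a | passmx.leigenvalue A a]%classic
     => \dim (passmx.leigenspace A a) | 0%N].

Lemma finite_eigenvalues (A : 'End(U)) :
  finite_set [set a | passmx.leigenvalue A a]%classic.
Proof.
pose M := passmx.mxof (vbasis {:U}) (vbasis {:U}) A.
have root_M a : passmx.leigenvalue A a -> root (char_poly M) a.
  rewrite /passmx.leigenvalue (passmx.leigenspaceE (vbasisP {:U})).
  by rewrite (passmx.vsof_eq0 (vbasisP {:U})) -eigenvalue_root_char.
apply: contrapT => /(@infinite_set_fset _ _ (size (char_poly M)))[B BA].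
apply/negP; rewrite -ltnNge.
apply: max_poly_roots; rewrite ?monic_neq0 ?char_poly_monic ?fset_uniq //.
by apply/allP => a /BA /root_M.
Qed.

Lemma specE (A : 'End(U)) a : spec A a = \dim (passmx.leigenspace A a).
Proof.
rewrite fsfunE in_fset_set ?inE /=; last exact: finite_eigenvalues.
by case: ifPn; rewrite ?notin_setE /= // /passmx.leigenvalue; case: eqP => [->|//]; rewrite dimv0.
Qed.

Definition spec_nz (A : 'End(U)) : {mset R}%mset :=
  (spec A `\` msetn (spec A 0) 0)%mset.

Lemma spec_nzE (A : 'End(U)) a :
  spec_nz A a = if a == 0 then 0%N else \dim (passmx.leigenspace A a).
Proof.
by rewrite msetE2 msetnE !specE; case: eqP => [->|_]; rewrite ?subnn ?subn0.
Qed.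

End Spectrum.

Section Laplacians.
Variables (R : realType) (V : finType) (E : rel V).
Variable ip : forall m, {dot Om R E m for idfun}.

Definition bdO_adj p : 'Hom(Om R E p, Om R E p.+1) :=
  adjoint (ip p.+1) (ip p) (bdO R E p).

(* The operator L_p. *)
Definition downLap p : 'End(Om R E p.+1) := (bdO_adj p \o bdO R E p)%VF.

Definition HodgeLap p : 'End(Om R E p.+1) :=
  (bdO R E p.+1 \o bdO_adj p.+1)%VF + (bdO_adj p \o bdO R E p)%VF.

End Laplacians.

(* Main.v *)
Require Import Defs.
From mathcomp Require Import all_boot all_order all_algebra.
From mathcomp Require Import zify.
From mathcomp Require Import finmap multiset reals.

Local Open Scope ring_scope.

(** Fix a nonzero [a] and write [d n] and [h n] for the multiplicities of [a] in
    the spectra of [L_n] and of [Delta_n]. Two facts give [h n = d n + d n.+1].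
    - [Delta_n] is the sum of [L_n] and of the upper Laplacian, and the product
      of these two operators vanishes in both orders because the square of the
      boundary and that of its adjoint are zero; for such a pair the
      eigenspaces at [a] are independent and add up to the eigenspace of the sum
      ([dim_leigenspace_add]).
    - The upper Laplacian in degree [n] and [L_(n+1)] are the two products of
      the boundary and its adjoint, and the eigenspaces at [a <> 0] of [f g] and
      [g f] are isomorphic through [f] and [g] ([dim_leigenspace_comp]).
    Since the complex stops in degree 0, [d 0 = 0], and therefore
    [h (n - 1) - h (n - 2) + h (n - 3) - ...] telescopes to [d n]
    ([sum_alternate_telescope]). In this form, with the negative terms moved to
    the other side, the identity also shows that the multiset to be subtracted
    is contained in the other one. *)

Section Eigenspaces.
Import GRing.Theory.

Lemma leigenspaceP (F : fieldType) (U : vectType F) (f : 'End(U)) (a : F) u :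
  reflect (f u = a *: u) (u \in passmx.leigenspace f a).
Proof.
rewrite memv_ker add_lfunE opp_lfunE scale_lfunE id_lfunE subr_eq0.
exact: eqP.
Qed.

Lemma leq_dim_leigenspace_comp (F : fieldType) (U W : vectType F)
    (f : 'Hom(U, W)) (g : 'Hom(W, U)) (a : F) :
  a != 0 ->
  (\dim (passmx.leigenspace (g \o f)%VF a)
     <= \dim (passmx.leigenspace (f \o g)%VF a))%N.
Proof.
move=> a0; set X := passmx.leigenspace (g \o f)%VF a.
have kerX : (X :&: lker f)%VS = 0%VS.
  apply/eqP; rewrite -subv0; apply/subvP => u.
  rewrite memv_cap memv_ker memv0 => /andP[/leigenspaceP + /eqP fu0].
  rewrite comp_lfunE fu0 linear0 => /esym/eqP.
  by rewrite scaler_eq0 (negPf a0).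
rewrite -(limg_dim_eq kerX); apply: dimvS; apply/subvP => _ /memv_imgP[u Xu ->].
apply/leigenspaceP; move/leigenspaceP: Xu; rewrite !comp_lfunE => ->.
exact: linearZ.
Qed.

(** The map [f] sends the eigenspace of [g f] into that of [f g], injectively
    because [g f] acts there as an invertible scalar; exchange [f] and [g] for
    the other inequality. *)
Lemma dim_leigenspace_comp (F : fieldType) (U W : vectType F)
    (f : 'Hom(U, W)) (g : 'Hom(W, U)) (a : F) :
  a != 0 ->
  \dim (passmx.leigenspace (g \o f)%VF a)
    = \dim (passmx.leigenspace (f \o g)%VF a).
Proof. by move=> a0; apply/eqP; rewrite eqn_leq !leq_dim_leigenspace_comp. Qed.

(** On an eigenvector [u] of [f + g], applying [f] (resp. [g]) once more shows
    that [f u] and [g u] are eigenvectors of [f] and [g] with the same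
    eigenvalue, and [u] is [a^-1] times their sum. *)
Lemma dim_leigenspace_add (F : fieldType) (U : vectType F) (f g : 'End(U)) (a : F) :
    a != 0 -> (forall u, f (g u) = 0) -> (forall u, g (f u) = 0) ->
  \dim (passmx.leigenspace (f + g)%VF a)
    = (\dim (passmx.leigenspace f a) + \dim (passmx.leigenspace g a))%N.
Proof.
move=> a0 fg0 gf0.
have kill (f1 f2 : 'End(U)) u : (forall v, f2 (f1 v) = 0) ->
    u \in passmx.leigenspace f1 a -> f2 u = 0.
  move=> f210 /leigenspaceP f1u; apply: (scalerI a0).
  by rewrite -linearZ -f1u scaler0; apply: f210.
have cap0 : (passmx.leigenspace f a :&: passmx.leigenspace g a)%VS = 0%VS.
  apply/eqP; rewrite -subv0; apply/subvP => u.
  rewrite memv_cap memv0 => /andP[fu /leigenspaceP].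
  rewrite (kill _ _ _ gf0 fu) => /esym/eqP.
  by rewrite scaler_eq0 (negPf a0).
rewrite -dimv_disjoint_sum //; congr (\dim _); apply/eqP.
rewrite eqEsubv subv_add; apply/and3P; split; apply/subvP => u.
- move=> /leigenspaceP; rewrite add_lfunE => fgu.
  have -> : u = a^-1 *: f u + a^-1 *: g u.
    by rewrite -scalerDr fgu scalerA mulVf // scale1r.
  apply: memv_add; apply: rpredZ; apply/leigenspaceP.
    by rewrite -[RHS]linearZ -fgu linearD /= fg0 addr0.
  by rewrite -[RHS]linearZ -fgu linearD /= gf0 add0r.
- move=> fu; apply/leigenspaceP.
  by rewrite add_lfunE (kill _ _ _ gf0 fu) addr0; apply/leigenspaceP.
- move=> gu; apply/leigenspaceP.
  by rewrite add_lfunE (kill _ _ _ fg0 gu) add0r; apply/leigenspaceP.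
Qed.

End Eigenspaces.

Lemma spec_nz_add (R : realType) (U1 U2 U3 : vectType R)
    (f : 'End(U1)) (g : 'End(U2)) (h : 'End(U3)) (a : R) :
    (a != 0 -> \dim (passmx.leigenspace f a)
      = (\dim (passmx.leigenspace g a) + \dim (passmx.leigenspace h a))%N) ->
  spec_nz f a = (spec_nz g a + spec_nz h a)%N.
Proof. by move=> dimE; rewrite !spec_nzE; case: eqVneq. Qed.

Section PathLaplacians.
Variables (R : realType) (V : finType) (E : rel V).
Variable ip : forall m, {dot Om R E m for idfun}.
Import GRing.Theory.

Lemma bdO_bdO m (u : Om R E m.+2) : bdO R E m (bdO R E m.+1 u) = 0.
Proof. by apply: val_inj; rewrite /= !bdOE bd_bd. Qed.

Lemma bdO_adj_adj m (u : Om R E m) : bdO_adj ip m.+1 (bdO_adj ip m u) = 0.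
Proof.
apply: (@dot_inj _ _ (ip m.+2)) => v.
by rewrite -!adjointP bdO_bdO linear0l linear0r.
Qed.

Lemma Om0_eq0 (u : Om R E 0) : u = 0.
Proof. by apply: val_inj; apply: chain0. Qed.

(** Degree 0 is the bottom of the complex: the boundary vanishes there. *)
Lemma dim_leigenspace_downLap0 (a : R) :
  a != 0 -> \dim (passmx.leigenspace (downLap ip 0) a) = 0%N.
Proof.
move=> a0; apply/eqP; rewrite dimv_eq0 -subv0; apply/subvP => u /leigenspaceP.
rewrite comp_lfunE [bdO _ _ _ _]Om0_eq0 linear0 => /esym/eqP.
by rewrite scaler_eq0 (negPf a0) memv0.
Qed.

Lemma dim_leigenspace_HodgeLap n (a : R) :
  a != 0 ->
  \dim (passmx.leigenspace (HodgeLap ip n) a)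
    = (\dim (passmx.leigenspace (downLap ip n) a)
       + \dim (passmx.leigenspace (downLap ip n.+1) a))%N.
Proof.
move=> a0; rewrite /HodgeLap dim_leigenspace_add //.
- by rewrite addnC /downLap (dim_leigenspace_comp _ _ _ (bdO R E n.+1)).
- by move=> u; rewrite !comp_lfunE bdO_adj_adj linear0.
- by move=> u; rewrite !comp_lfunE bdO_bdO linear0.
Qed.

Lemma spec_nz_downLap0 (a : R) : spec_nz (downLap ip 0) a = 0%N.
Proof.
by rewrite spec_nzE; case: eqVneq => // a0; apply: dim_leigenspace_downLap0.
Qed.

Lemma spec_nz_HodgeLap n (a : R) :
  spec_nz (HodgeLap ip n) a
    = (spec_nz (downLap ip n) a + spec_nz (downLap ip n.+1) a)%N.
Proof.
by apply: spec_nz_add; apply: dim_leigenspace_HodgeLap.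
Qed.

End PathLaplacians.

(** In the induction step from [p] to [p.+2], the left side gains [h p.+1], and
    the right side gains [h p] while [d p] is replaced by [d p.+2]: both changes
    amount to [d p.+1 + d p.+2]. *)
Lemma sum_alternate_telescope (h d : nat -> nat) p :
    d 0%N = 0%N -> (forall n, h n = d n + d n.+1)%N ->
  (\sum_(0 <= k < p.+1 %/ 2) h (p - (2 * k + 1))
     = \sum_(1 <= k < (p %/ 2).+1) h (p - 2 * k) + d p)%N.
Proof.
move=> d0 hd; elim/ltn_ind: p => -[|[|p]] IH.
- by rewrite !big_geq.
- by rewrite big_nat1 big_geq // hd d0.
have -> : (p.+3 %/ 2 = (p.+1 %/ 2).+1)%N by lia.
have -> : (p.+2 %/ 2 = (p %/ 2).+1)%N by lia.
rewrite big_nat_recl // (@big_nat_recl _ _ _ _ 1) //.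
have shift_odd k : (p.+2 - (2 * k.+1 + 1) = p - (2 * k + 1))%N by lia.
have shift_even k : (p.+2 - 2 * k.+1 = p - 2 * k)%N by lia.
under eq_bigr do rewrite shift_odd.
under [in RHS]eq_bigr do rewrite shift_even.
rewrite IH //.
have -> : (p.+2 - (2 * 0 + 1) = p.+1)%N by lia.
have -> : (p.+2 - 2 * 1 = p)%N by lia.
by rewrite !hd; lia.
Qed.

Lemma big_msetDE (K : choiceType) (I : Type) (r : seq I)
    (F : I -> {mset K}%mset) a :
  (\big[msetD/mset0]_(i <- r) F i)%mset a = (\sum_(i <- r) F i a)%N.
Proof.
apply: (big_morph (fun A : {mset K}%mset => A a)) => [A B|].
  by rewrite msetE2.
exact: mset0E.
Qed.

Theorem lemma3p5 (R : realType) (V : finType) (E : rel V)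
    (E_irr : irreflexive E) (ip : forall m, {dot Om R E m for idfun})
    (p : nat) (p_ge1 : (1 <= p)%N) :
  let A := \big[msetD/mset0]_(0 <= k < ((p - 1) %/ 2).+1)
             spec_nz (HodgeLap ip (p - (2 * k + 1))) in
  let B := \big[msetD/mset0]_(1 <= k < (p %/ 2).+1)
             spec_nz (HodgeLap ip (p - 2 * k)) in
  (B `<=` A)%mset /\ spec_nz (downLap ip p) = (A `\` B)%mset.
Proof.
move=> A B.
have AB a : A a = (B a + spec_nz (downLap ip p) a)%N.
  rewrite !big_msetDE.
  have -> : (((p - 1) %/ 2).+1 = p.+1 %/ 2)%N by lia.
  apply: (sum_alternate_telescope (fun n => spec_nz (HodgeLap ip n) a)
                                  (fun n => spec_nz (downLap ip n) a)) => [|n].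
    exact: spec_nz_downLap0.
  exact: spec_nz_HodgeLap.
split; first by apply/msubsetP => a; rewrite AB leq_addr.
by apply/msetP => a; rewrite msetE2 AB addKn.
Qed.
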